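(* If $\ell$ and $\ell'$ are load functions on the hypergraph $\mathcal{H}=(V,\mathcal{E})$ such that $\ell(E)\le\ell'(E)$ holds for every $E\in\mathcal{E}$, then $\tau_g^*(\mathcal{H}|\ell)\ge\tau_g^*(\mathcal{H}|\ell')$, and similarly ${\tau_g^*}'(\mathcal{H}|\ell)\ge{\tau_g^*}'(\mathcal{H}|\ell')$.
   Context: A hypergraph $\mathcal{H}=(V,\mathcal{E})$ has a finite vertex set $V$ and an edge set $\mathcal{E}\subseteq 2^V\setminus\{\emptyset\}$. A cover function is a function $t:V\to[0,1]$, with $|t|=\sum_{v\in V}t(v)$; the load function corresponding to it is $\mathcal{E}\to[0,1]$, $E\mapsto\min\{1,\sum_{v\in E}t(v)\}$. Given a load function $\ell$ on $\mathcal{H}$ (a pre-defined starting configuration), the fractional transversal game on $\mathcal{H}|\ell$ is played as follows. Edge-hitter and Staller take turns making moves, updating a cover function; $t_i$ and $\ell_i$ denote the cover and load functions after the $i$-th move. Initially $t_0\equiv0$ and $\ell_0=\ell$, and $\ell_i(E)=\min\{1,\ell(E)+\sum_{v\in E}t_i(v)\}$. The game is finished when the load is $\equiv1$ on $\mathcal{E}$. As long as it is not, the next player performs a move, which is a finite or infinite sequence of submoves $(u_1,w_1),(u_2,w_2),\dots$, where $u_k\in V$ (repetitions allowed) and $w_k\in[0,1]$. It is required that $\sum_kw_k=1$ in each move except the last move of the game, where $\sum_kw_k\le1$ suffices. The $i$-th move must be legal: for every $k\ge1$ there is an edge $E\in\mathcal{E}$ with $u_k\in E$ and $\ell_{i-1}(E)+\sum_{1\le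 s\le k-1,\,u_s\in E}w_s+w_k\le1$. The function $t_i$ is obtained from $t_{i-1}$ by adding $w_k$ to the value at $u_k$ for every submove. The value $|\mathcal{G}|$ of a game is $|t_q|$ for the final cover function $t_q$, i.e. the total weight spent during the game. Edge-hitter wants it small, Staller wants it large. $\tau_g^*(\mathcal{H}|\ell)$ is the value under optimal play when Edge-hitter starts, i.e. the infimum of all $a$ such that Edge-hitter has a strategy ensuring $|\mathcal{G}|\le a$; ${\tau_g^*}'(\mathcal{H}|\ell)$ is defined analogously when Staller makes the first move. *)

(* Defs.v *)
From HB Require Import structures.
From mathcomp Require Import all_boot all_order all_algebra.
From mathcomp Require Import all_classical all_reals all_analysis.

Set Implicit Arguments.
Unset Strict Implicit.
Unset Printing Implicit Defensive.

Import Order.TTheory GRing.Theory Num.Theory.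

Local Open Scope ring_scope.

Record hypergraph (V : finType) := Hypergraph {
  edges :> {set {set V}};
  edges_neq0 : finset.set0 \notin edges }.

Definition load_function (R : realType) (V : finType) (H : hypergraph V)
    (l : {set V} -> R) : Prop :=
  forall E, E \in H -> 0 <= l E <= 1.

Inductive move (R : realType) (V : finType) :=
  | FinMove of seq (V * R)
  | InfMove of (nat -> V * R).

Inductive player := EdgeHitter | Staller.

Definition opponent (p : player) : player :=
  if p is EdgeHitter then Staller else EdgeHitter.

(* Moves are numbered from 0: [on_turn first i] makes the move that follows a
   history of length [i]. *)
Definition on_turn (first : player) (i : nat) : player :=
  if odd i then opponent first else first.

Section Game.
Context {R : realType} {V : finType}.
Implicit Types (m : move R V) (h : seq (move R V)) (l : {set V} -> R).

(* Submoves are numbered from 0. *)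
Definition submove m (k : nat) : option (V * R) :=
  match m with
  | FinMove s => onth s k
  | InfMove f => Some (f k)
  end.

Definition submove_weight m (A : {pred V}) (k : nat) : R :=
  if submove m k is Some (u, w) then (if u \in A then w else 0) else 0.

(* Extended-real valued, so that a divergent series of weights is not
   mistaken for a finite total. *)
Definition weight m (A : {pred V}) : \bar R :=
  (\sum_(0 <= k <oo) (submove_weight m A k)%:E)%E.

(* A history [h] lists the moves made so far, oldest first.  Legality alone
   keeps the values of [cover_fun h] in [0, 1]: a submove of positive weight at [u]
   needs an edge through [u] whose uncapped load stays at most 1. *)
Definition cover_fun h (v : V) : R := \sum_(m <- h) fine (weight m (pred1 v)).

Definition load l h (E : {set V}) : R :=
  Num.min 1 (l E + \sum_(v in E) cover_fun h v).

Definition value h : R := \sum_(v : V) cover_fun h v.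

Variable H : hypergraph V.

Definition finished l h : Prop := forall E, E \in H -> load l h E = 1.

Definition legal_submoves l h m : Prop :=
  forall k u w, submove m k = Some (u, w) ->
    0 <= w <= 1 /\
    exists E : {set V}, [/\ E \in H, u \in E &
      load l h E + \sum_(0 <= s < k) submove_weight m E s + w <= 1].

Definition legal_move l h m : Prop :=
  legal_submoves l h m /\
  (weight m predT = 1%E \/
   (weight m predT <= 1)%E /\ finished l (rcons h m)).

(* Strategies of Edge-hitter may depend on the whole history. *)
Definition strategy := seq (move R V) -> move R V.

Inductive play l (first : player) (sigma : strategy) : seq (move R V) -> Prop :=
  | play_nil : play l first sigma [::]
  | play_rcons h m :
      play l first sigma h -> ~ finished l h -> legal_move l h m ->
      (on_turn first (size h) = EdgeHitter -> m = sigma h) ->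
      play l first sigma (rcons h m).

(* No infinite play exists: each submove of weight [w] adds [w] to the load of
   some edge without exceeding 1, so at most #|H| can be spent altogether, while
   every move but the last spends 1.  For the same reason, and as edges are
   nonempty, an unfinished game always admits a legal move. *)
Definition ensures l (first : player) (sigma : strategy) (a : R) : Prop :=
  forall h, play l first sigma h ->
    (finished l h -> value h <= a) /\
    (~ finished l h -> on_turn first (size h) = EdgeHitter ->
     legal_move l h (sigma h)).

Definition game_value l (first : player) : \bar R :=
  ereal_inf [set a%:E | a in
    [set a : R | exists sigma, ensures l first sigma a]]%classic.

Definition tau_g l : \bar R := game_value l EdgeHitter.

Definition tau_g' l : \bar R := game_value l Staller.

End Game.

(* Main.v *)
Require Import Defs.
From HB Require Import structures.
From mathcomp Require Import all_boot all_order all_algebra.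
From mathcomp Require Import all_classical all_reals all_analysis.
From mathcomp Require Import lra.

Set Implicit Arguments.
Unset Strict Implicit.
Unset Printing Implicit Defensive.

Import Order.TTheory GRing.Theory Num.Theory.

Local Open Scope ring_scope.

(** The proof is an imagination strategy.  Write l <= l', and let sigma ensure
    the value a on H|l.  While the real game is played on H|l', Edge-hitter
    keeps an imagined game on H|l: every move that Staller makes in the real
    game is copied into the imagined one, and in the imagined game Edge-hitter
    herself follows sigma.  The invariant is that both games have the same
    number of moves and that on each edge the imagined load is at most the real
    one.

    Copying Staller's moves is harmless: legality only requires room in some
    edge, and there is more room in the imagined game
    ([legal_submoves_dom]).  The moves of Edge-hitter go the other way and may
    not fit.  She therefore trims them ([trim_requests]): she takes the total
    weight that sigma puts on each vertex, and spends on that vertex as much of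
    it as still fits.  A vertex where something was cut off has all its
    edges full, so an edge either receives the whole imagined weight or is full,
    and the invariant survives.  The order of the submoves in sigma's move is
    irrelevant here, so that a possibly infinite move is answered by a finite
    one.  What remains of the unit of weight is then spent greedily
    ([extend_legal]); see [trimmed_response].

    All moves before the last one weigh exactly 1, so the values of the two
    games agree up to the last real move.  If that move is Edge-hitter's, it is
    at most as heavy as the imagined one.  If it is Staller's, it may weigh less
    than 1 because it ends the real game, while the imagined game goes on and
    the copy is too light to be legal.  But a finite prefix of it, of weight
    within eps of the whole, extends to a legal imagined move
    ([legal_move_near]); hence the real value is at most eps plus
    the value of some imagined play.  Finally, any play according to sigma, even
    unfinished, has value at most a ([ensures_play_value]): it can be continued
    to the end, since legality keeps the cover function at most 1, so that only
    #|V| moves of weight 1 fit in. *)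

(** * Weights of moves *)

Section Weights.
Context {R : realType} {V : finType}.
Implicit Types (m : move R V) (h : seq (move R V)) (l : {set V} -> R).
Implicit Types (s : seq (V * R)) (A : {pred V}) (E : {set V}).

Definition spent m A : R := fine (weight m A).

(** The part of legality that does not refer to the hypergraph; it is what makes
    the series of weights converge and commute with finite sums. *)
Definition admissible m : Prop :=
  (forall k u w, submove m k = Some (u, w) -> 0 <= w) /\
  (weight m predT <= 1)%E.

Lemma submove_weight_ge0 m A k : admissible m -> 0 <= submove_weight m A k.
Proof.
move=> [w_ge0 _]; rewrite /submove_weight.
by case Dk: (submove m k) => [[u w]|] //; case: ifP => // _; exact: w_ge0 Dk.
Qed.

Lemma submove_weight_sum m A k :
  submove_weight m A k = \sum_(v in A) submove_weight m (pred1 v) k.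
Proof.
rewrite /submove_weight; case: (submove m k) => [[u w]|]; last by rewrite big1.
case: ifP => [uA|/negP uA].
  rewrite (bigD1 u) //= inE eqxx big1 ?addr0 // => v /andP[_ /negPf vu].
  by rewrite inE eq_sym vu.
rewrite big1 // => v vA; rewrite inE; case: eqP => // uv.
by case: uA; rewrite uv.
Qed.

Lemma submove_weight_mono m A B k : admissible m -> {subset A <= B} ->
  submove_weight m A k <= submove_weight m B k.
Proof.
move=> [w_ge0 _] AB; rewrite /submove_weight.
case Dk: (submove m k) => [[u w]|] //.
case: ifP => [/AB -> //|_]; case: ifP => // _; exact: w_ge0 Dk.
Qed.

Lemma weightE m A : admissible m -> weight m A = (spent m A)%:E.
Proof.
move=> adm_m; rewrite /spent fineK // ge0_fin_numE; last first.
  by apply: nneseries_ge0 => k _ _; rewrite lee_fin submove_weight_ge0.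
apply: (@le_lt_trans _ _ (weight m predT)); last first.
  by apply: (le_lt_trans adm_m.2); rewrite ltry.
apply: lee_nneseries => k _; first by rewrite lee_fin submove_weight_ge0.
by rewrite lee_fin submove_weight_mono.
Qed.

Lemma partial_le_spent m A n : admissible m ->
  \sum_(0 <= k < n) submove_weight m A k <= spent m A.
Proof.
move=> adm_m; rewrite -lee_fin -weightE // -sumEFin.
by apply: nneseries_lim_ge => k _ _; rewrite lee_fin submove_weight_ge0.
Qed.

Lemma spent_le_sup m A c : admissible m ->
  (forall n, \sum_(0 <= k < n) submove_weight m A k <= c) -> spent m A <= c.
Proof.
move=> adm_m le_c; rewrite -lee_fin -weightE //.
apply: lime_le.
  by apply: is_cvg_nneseries => k _ _; rewrite lee_fin submove_weight_ge0.
by near=> n; rewrite sumEFin lee_fin.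
Unshelve. all: by end_near. Qed.

Lemma spent_ge0 m A : admissible m -> 0 <= spent m A.
Proof. by move=> /(partial_le_spent A 0); rewrite big_geq. Qed.

Lemma spent_le1 m : admissible m -> spent m predT <= 1.
Proof. by move=> adm_m; rewrite -lee_fin -weightE //; case: adm_m. Qed.

Lemma spent_sum m A : admissible m ->
  spent m A = \sum_(v in A) spent m (pred1 v).
Proof.
move=> adm_m; apply: EFin_inj; rewrite -weightE // -sumEFin.
under [RHS]eq_bigr do rewrite -weightE //.
rewrite -nneseries_sum; last first.
  by move=> v k _; rewrite lee_fin submove_weight_ge0.
by apply: eq_eseriesr => k _; rewrite submove_weight_sum sumEFin.
Qed.

Lemma cover_fun_rcons h m v :
  cover_fun (rcons h m) v = cover_fun h v + spent m (pred1 v).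
Proof. by rewrite /cover_fun -cats1 big_cat big_seq1. Qed.

Lemma load_rcons l h m E : admissible m ->
  load l (rcons h m) E = Num.min 1 (load l h E + spent m E).
Proof.
move=> adm_m; have := spent_ge0 E adm_m; rewrite /load => m_ge0.
under eq_bigr do rewrite cover_fun_rcons.
rewrite big_split /= -spent_sum // addrA.
set y := l E + _; case: (leP 1 y) => y1; last by [].
by rewrite !min_l //; lra.
Qed.

Lemma value_rcons h m : admissible m ->
  value (rcons h m) = value h + spent m predT.
Proof.
move=> adm_m; rewrite /value; under eq_bigr do rewrite cover_fun_rcons.
by rewrite big_split /= [in RHS]spent_sum.
Qed.

Lemma load_le1 l h E : load l h E <= 1.
Proof. by rewrite /load ge_min lexx. Qed.

Definition total s A : R := \sum_(p <- s | p.1 \in A) p.2.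

Lemma total_nil A : total [::] A = 0.
Proof. by rewrite /total big_nil. Qed.

Lemma total_cat s1 s2 A : total (s1 ++ s2) A = total s1 A + total s2 A.
Proof. by rewrite /total big_cat. Qed.

Lemma total_seq1 u w A : total [:: (u, w)] A = if u \in A then w else 0.
Proof. by rewrite /total big_mkcond big_seq1. Qed.

Lemma total_cons u w s A :
  total ((u, w) :: s) A = (if u \in A then w else 0) + total s A.
Proof. by rewrite -cat1s total_cat total_seq1. Qed.

Lemma partial_list s A n :
  \sum_(0 <= k < n) submove_weight (FinMove s) A k = total (take n s) A.
Proof.
elim: s n => [|[u w] s IHs] n; first by rewrite big1 ?total_nil // => -[].
case: n => [|n]; first by rewrite big_geq ?total_nil.
by rewrite big_nat_recl //= total_cons -IHs.
Qed.

Lemma weight_list s A : weight (FinMove s) A = (total s A)%:E.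
Proof.
apply: cvg_lim => //; apply: cvg_near_cst; near=> n.
rewrite sumEFin partial_list take_oversize //.
by near: n; exact: nbhs_infty_ge.
Unshelve. all: by end_near. Qed.

Lemma spent_list s A : spent (FinMove s) A = total s A.
Proof. by rewrite /spent weight_list. Qed.

End Weights.

(** * Legality and greedy completion of finite moves *)

Section Legality.
Context {R : realType} {V : finType}.
Variable H : hypergraph V.
Implicit Types (m : move R V) (h : seq (move R V)) (l : {set V} -> R).
Implicit Types (s : seq (V * R)) (A : {pred V}) (E : {set V}).

Lemma legal_admissible l h m : legal_move H l h m -> admissible m.
Proof.
case=> leg_m wm; split; last by case: wm => [->|[]].
by move=> k u w /leg_m[/andP[]].
Qed.

Lemma submove_rcons s u w k :
  submove (FinMove (rcons s (u, w))) k =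
    if (k < size s)%N then submove (FinMove s) k
    else if k == size s then Some (u, w) else None.
Proof. elim: s k => [|x s IHs] [|k] //=; first by case: k.
exact: IHs. Qed.

Lemma legal_submoves_nil l h : legal_submoves H l h (FinMove [::]).
Proof. by case. Qed.

Lemma legal_submoves_rcons l h s u w E :
  legal_submoves H l h (FinMove s) -> 0 <= w <= 1 ->
  E \in H -> u \in E -> load l h E + total s E + w <= 1 ->
  legal_submoves H l h (FinMove (rcons s (u, w))).
Proof.
move=> leg_s w01 HE uE leE k u' w'; rewrite submove_rcons.
case: ltnP => [ltks /leg_s[w'01 [F [HF u'F leF]]]|_].
  split=> //; exists F; split=> //; move: leF; rewrite !partial_list.
  by rewrite -cats1 takel_cat // ltnW.
case: eqP => // -> [<- <-]; split=> //; exists E; split=> //.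
by rewrite partial_list -cats1 take_size_cat.
Qed.

Lemma legal_total_ge0 l h s A :
  legal_submoves H l h (FinMove s) -> 0 <= total s A.
Proof.
move=> leg_s; rewrite -[s]take_size -partial_list sumr_ge0 // => k _.
rewrite /submove_weight; case Dk: submove => [[u w]|] //.
by have [/andP[w_ge0 _] _] := leg_s _ _ _ Dk; case: ifP.
Qed.

Lemma list_admissible l h s : legal_submoves H l h (FinMove s) ->
  total s predT <= 1 -> admissible (FinMove s).
Proof.
move=> leg_s s_le1; split; last by rewrite weight_list lee_fin.
by move=> k u w /leg_s[/andP[]].
Qed.

(** Smaller loads leave more room, and the same witnessing edges do. *)
Lemma legal_submoves_dom l l' h h' m :
  (forall E, E \in H -> load l h E <= load l' h' E) ->
  legal_submoves H l' h' m -> legal_submoves H l h m.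
Proof.
move=> dom leg_m k u w /leg_m[w01 [E [HE uE leE]]]; split=> //.
by exists E; split=> //; have := dom E HE; lra.
Qed.

Lemma finished_dom l l' h h' :
  (forall E, E \in H -> load l h E <= load l' h' E) ->
  finished H l h -> finished H l' h'.
Proof.
move=> dom fin_h E HE; apply/eqP; rewrite eq_le load_le1 /=.
by rewrite -(fin_h E HE) dom.
Qed.

(** Stated with the uncapped sum, so that it is a linear condition. *)
Definition fills l h s E : Prop := 1 <= load l h E + total s E.

Lemma fills_cat l h s1 s2 E :
  0 <= total s2 E -> fills l h s1 E -> fills l h (s1 ++ s2) E.
Proof. by rewrite /fills total_cat; lra. Qed.

(** The roomiest edge through u decides: if it can take b, then all of b is
    spent on u; otherwise spending exactly its remaining room fills every edge
    through u.  The list [s2] is empty rather than a submove of weight 0 when all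
    edges through u are full, since edges filled beyond 1 within
    the move make even a null submove illegal. *)
Lemma fill_vertex l h s u b :
  legal_submoves H l h (FinMove s) -> 0 <= b <= 1 ->
  exists2 w, 0 <= w <= b & exists s2,
   [/\ legal_submoves H l h (FinMove (s ++ s2)),
       forall A, total s2 A = if u \in A then w else 0 &
       w = b \/
       forall E, E \in H -> u \in E -> fills l h (s ++ s2) E].
Proof.
move=> leg_s b01; pose c E := load l h E + total s E.
have [[E [HE uE cE]]|no_room] :=
    pselect (exists E, [/\ E \in H, u \in E & c E <= 1 - b]).
  exists b; first by lra.
  exists [:: (u, b)]; split; last by left.
    rewrite cats1; apply: legal_submoves_rcons HE uE _ => //.
    by move: cE; rewrite /c; lra.
  by move=> A; rewrite total_seq1.
have c_gt E : E \in H -> u \in E -> 1 - b < c E.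
  move=> HE uE; rewrite ltNge; apply/negP => cE; apply: no_room.
  by exists E.
have [[E0 [HE0 uE0 cE0]]|full] :=
    pselect (exists E, [/\ E \in H, u \in E & c E < 1]); last first.
  exists 0; first by lra.
  exists [::]; rewrite cats0; split=> // [A|].
    by rewrite total_nil if_same.
  right=> E HE uE; rewrite /fills leNgt; apply/negP => cE; apply: full.
  by exists E.
have P0 : (E0 \in H) && (u \in E0) by rewrite HE0.
have [E /andP[HE uE] minE] :=
  arg_minP (P := fun E => (E \in H) && (u \in E)) c P0.
have cE : c E < 1 by apply: le_lt_trans cE0; apply: minE.
have cEb := c_gt _ HE uE.
exists (1 - c E); first by lra.
exists [:: (u, 1 - c E)]; split=> [|A|].
- rewrite cats1; apply: legal_submoves_rcons HE uE _ => //; first by lra.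
  by rewrite -/(c E); lra.
- by rewrite total_seq1.
right=> F HF uF; rewrite /fills total_cat total_seq1 uF addrA -/(c F).
have := minE F; rewrite HF uF => /(_ isT); lra.
Qed.

(** Each request is served up to the room left at its vertex.  A request
    that is cut leaves all edges at its vertex full, so the load of an edge
    suffers from trimming only if the edge is full anyway. *)
Lemma trim_requests l h s r :
  legal_submoves H l h (FinMove s) -> all (fun p => 0 <= p.2 <= 1) r ->
  exists s2,
   [/\ legal_submoves H l h (FinMove (s ++ s2)),
       forall A, 0 <= total s2 A <= total r A &
       forall E, E \in H ->
         total r E <= total s2 E \/ fills l h (s ++ s2) E].
Proof.
elim: r s => [|[u b] r IHr] s leg_s /=.
  move=> _; exists [::]; rewrite cats0; split=> // [A|E _].
    by rewrite total_nil lexx.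
  by left.
case/andP=> b01 r01.
have [w w_b [s1 [leg_s1 tot_s1 full1]]] := fill_vertex u leg_s b01.
have [s2 [leg_s2 tot_s2 full2]] := IHr _ leg_s1 r01.
exists (s1 ++ s2); rewrite catA; split=> // [A|E HE].
  rewrite total_cat total_cons tot_s1; have := tot_s2 A.
  by case: ifP => _; lra.
rewrite total_cat total_cons tot_s1.
have [s2_ge0 _] := andP (tot_s2 E).
case: (full2 E HE) => [le2|]; last by right.
case: ifP => uE; last by left; lra.
case: full1 => [->|/(_ E HE uE) full_s1]; first by left; lra.
by right; exact: fills_cat.
Qed.

(** Visiting the vertices once suffices: a vertex is left either with the budget
    exhausted or with all its edges full. *)
Lemma extend_budget l h s b (vs : seq V) :
  legal_submoves H l h (FinMove s) -> 0 <= b <= 1 ->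
  exists s2,
   [/\ legal_submoves H l h (FinMove (s ++ s2)),
       forall A, 0 <= total s2 A, total s2 predT <= b &
       total s2 predT = b \/
       forall E v, E \in H -> v \in E -> v \in vs -> fills l h (s ++ s2) E].
Proof.
elim: vs s b => [|u vs IHvs] s b leg_s b01.
  exists [::]; rewrite cats0; split=> // [A||]; rewrite ?total_nil //.
    by lra.
  by right.
have [w w_b [s1 [leg_s1 tot_s1 full1]]] := fill_vertex u leg_s b01.
have bw01 : 0 <= b - w <= 1 by lra.
have [s2 [leg_s2 s2_ge0 s2_le full2]] := IHvs _ _ leg_s1 bw01.
exists (s1 ++ s2); rewrite catA !total_cat !tot_s1 inE.
split=> // [A||]; last 1 first; last by lra.
- case: full2 => [->|full2]; first by left; lra.
  case: full1 => [wb|full1].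
    by left; have := s2_ge0 predT; lra.
  right=> E v HE vE; rewrite inE => /orP[/eqP uv|]; last exact: full2 vE.
  by subst v; apply: fills_cat => //; exact: full1.
rewrite total_cat tot_s1; have := s2_ge0 A; case: ifP => _; lra.
Qed.

Lemma finished_fills l h s : admissible (FinMove s) ->
  (forall E, E \in H -> fills l h s E) ->
  finished H l (rcons h (FinMove s)).
Proof.
move=> adm_s full E HE; rewrite load_rcons // spent_list.
by apply/min_idPl; exact: full.
Qed.

(** As edges are nonempty, filling the edges at every vertex fills them
    all. *)
Lemma extend_legal l h s :
  legal_submoves H l h (FinMove s) -> total s predT <= 1 ->
  exists s2,
   [/\ legal_move H l h (FinMove (s ++ s2)),
       forall A, 0 <= total s2 A &
       total (s ++ s2) predT = 1 \/
       forall E, E \in H -> fills l h (s ++ s2) E].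
Proof.
move=> leg_s s_le1.
have b01 : 0 <= 1 - total s predT <= 1.
  by have := legal_total_ge0 predT leg_s; lra.
have [s2 [leg_s2 s2_ge0 s2_le full]] := extend_budget (enum V) leg_s b01.
have tot_le1 : total (s ++ s2) predT <= 1 by rewrite total_cat; lra.
have adm := list_admissible leg_s2 tot_le1.
have full' : total (s ++ s2) predT = 1 \/
    forall E, E \in H -> fills l h (s ++ s2) E.
  case: full => [s2b|full]; first by left; rewrite total_cat; lra.
  right=> E HE; have /set0Pn[v vE] : E != finset.set0.
    by apply: contraTneq HE => ->; exact: edges_neq0.
  by apply: full HE vE _; rewrite mem_enum.
exists s2; split=> //; split=> //; rewrite weight_list.
case: full' => [->|full']; first by left.
by right; split; [rewrite lee_fin | exact: finished_fills].
Qed.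

End Legality.

(** * Finite approximation of infinite moves *)

Section Prefix.
Context {R : realType} {V : finType}.
Variable H : hypergraph V.
Implicit Types (m : move R V) (h : seq (move R V)) (l : {set V} -> R).

Definition prefix_move m n : seq (V * R) :=
  match m with FinMove s => take n s | InfMove f => mkseq f n end.

Lemma submove_prefix m n k :
  submove (FinMove (prefix_move m n)) k =
    if (k < n)%N then submove m k else None.
Proof.
case: m => [s|f] /=.
  by elim: s n k => [|x s IHs] [|n] [|k] //=; [rewrite if_same | exact: IHs].
have := onthE (mkseq f n) k => ->; rewrite /mkseq -map_comp.
case: ltnP => ltkn; first by rewrite (nth_map 0%N) ?size_iota ?nth_iota.
by rewrite nth_default // size_map size_iota.
Qed.

Lemma total_prefix m n A :
  total (prefix_move m n) A = \sum_(0 <= k < n) submove_weight m A k.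
Proof.
rewrite -[prefix_move m n]take_size -partial_list.
have le_sz : (size (prefix_move m n) <= n)%N.
  by case: m => [s|f] /=; rewrite ?size_mkseq // size_take_min geq_minl.
rewrite partial_list take_size -[LHS]/(total _ _).
rewrite -{1}(take_oversize le_sz) -partial_list.
apply: eq_big_nat => k /andP[_ ltkn].
by rewrite /submove_weight submove_prefix ltkn.
Qed.

Lemma legal_prefix l h m n : legal_submoves H l h m ->
  legal_submoves H l h (FinMove (prefix_move m n)).
Proof.
move=> leg_m k u w; rewrite submove_prefix; case: ltnP => // ltkn.
case/leg_m=> w01 [E [HE uE leE]]; split=> //; exists E; split=> //.
rewrite (eq_big_nat _ _ (F2 := submove_weight m E)) // => i /andP[_ ltik].
by rewrite /submove_weight submove_prefix (ltn_trans ltik).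
Qed.

(** A move of weight less than 1 that does not finish the game cannot be
    completed when it is infinite, as nothing can be appended to it.  A long
    enough finite prefix can, at the cost of eps. *)
Lemma legal_move_near l h m eps :
  legal_submoves H l h m -> (weight m predT <= 1)%E -> 0 < eps ->
  exists2 m2, legal_move H l h m2 & spent m predT - eps <= spent m2 predT.
Proof.
move=> leg_m m_le1 eps_gt0.
have adm_m : admissible m by split=> // k u w /leg_m[/andP[]].
have [n lt_n] : exists n,
    spent m predT - eps < \sum_(0 <= k < n) submove_weight m predT k.
  apply: contrapT => no_n.
  have : spent m predT <= spent m predT - eps.
    by apply: spent_le_sup => // n; rewrite leNgt; apply/negP => lt_n; case: no_n; exists n.
  by lra.
rewrite -total_prefix in lt_n.
have s_le1 : total (prefix_move m n) predT <= 1.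
  by rewrite total_prefix (le_trans (partial_le_spent _ _ _)) ?spent_le1.
have [s2 [leg s2_ge0 _]] := extend_legal (legal_prefix (n := n) leg_m) s_le1.
exists (FinMove (prefix_move m n ++ s2)) => //.
by rewrite spent_list total_cat; have := s2_ge0 predT; lra.
Qed.

End Prefix.

(** * Plays are short *)

Section Plays.
Context {R : realType} {V : finType}.
Variable H : hypergraph V.
Implicit Types (m : move R V) (h : seq (move R V)) (l : {set V} -> R).

(** The last submove of positive weight on v has room in an edge through v,
    whose load counts all the weight put on v so far. *)
Lemma cover_move_le1 l h m v : load_function H l ->
  (forall u, 0 <= cover_fun h u <= 1) -> legal_move H l h m ->
  cover_fun h v + spent m (pred1 v) <= 1.
Proof.
move=> l01 cov leg; have adm := legal_admissible leg.
have [cv0 cv1] := andP (cov v).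
suff: spent m (pred1 v) <= 1 - cover_fun h v by lra.
apply: spent_le_sup => // n; elim: n => [|n IHn].
  by rewrite big_geq //; lra.
rewrite big_nat_recr //= {2}/submove_weight.
case Dn: (submove m n) => [[u w]|]; last by rewrite addr0.
case: ifP => [|_]; last by rewrite addr0.
rewrite inE => /eqP uv; subst u.
have [/andP[w_ge0 _] [E [HE vE leE]]] := leg.1 _ _ _ Dn.
have [w0|w_neq0] := eqVneq w 0; first by rewrite w0 addr0.
have w_gt0 : 0 < w by rewrite lt_def w_neq0.
have le_sub : \sum_(0 <= k < n) submove_weight m (pred1 v) k <=
              \sum_(0 <= k < n) submove_weight m E k.
  apply: ler_sum => k _; apply: submove_weight_mono => // x.
  by rewrite inE => /eqP->.
have sub_ge0 : 0 <= \sum_(0 <= k < n) submove_weight m (pred1 v) k.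
  by apply: sumr_ge0 => k _; exact: submove_weight_ge0.
have cov_le : cover_fun h v <= \sum_(u in E) cover_fun h u.
  rewrite (bigD1 v) //= lerDl sumr_ge0 // => u _.
  by case/andP: (cov u).
have [lE_ge0 _] := andP (l01 E HE).
move: leE; rewrite /load.
by case: (leP 1 (l E + \sum_(u in E) cover_fun h u)); lra.
Qed.

Lemma play_cover_fun l first sigma h : load_function H l ->
  play H l first sigma h -> forall v, 0 <= cover_fun h v <= 1.
Proof.
move=> l01; elim=> [v|{}h m _ cov _ leg _ v].
  by rewrite /cover_fun big_nil lexx ler01.
rewrite cover_fun_rcons (cover_move_le1 _ l01) // andbT.
have := spent_ge0 (pred1 v) (legal_admissible leg).
by have := cov v; lra.
Qed.

Lemma play_unfinished_value l first sigma h :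
  play H l first sigma h -> ~ finished H l h -> value h = (size h)%:R.
Proof.
elim=> [_|{}h m _ IHh nfin_h leg _ nfin].
  by rewrite /value big1 // => v _; rewrite /cover_fun big_nil.
rewrite value_rcons; last exact: legal_admissible leg.
rewrite size_rcons -natr1 IHh //; congr (_ + _).
by case: leg => _ [|[_ /nfin]//]; rewrite /spent => ->.
Qed.

(** All moves of an unfinished play weigh 1, whereas each vertex carries at
    most 1. *)
Lemma play_unfinished_size l first sigma h : load_function H l ->
  play H l first sigma h -> ~ finished H l h -> (size h <= #|V|)%N.
Proof.
move=> l01 play_h nfin; rewrite -(ler_nat R).
rewrite -(play_unfinished_value play_h nfin) -sumr_const.
by apply: ler_sum => v _; have [] := andP (play_cover_fun l01 play_h v).
Qed.

Lemma legal_move_exists l h : exists m, legal_move H l h m.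
Proof.
have [|s2 [leg _ _]] := extend_legal (legal_submoves_nil H l h).
  by rewrite total_nil.
by exists (FinMove ([::] ++ s2)).
Qed.

(** The strategy only promises a bound on finished plays, but every play
    extends to a finished one, and values increase along it. *)
Lemma ensures_play_value l first sigma a h : load_function H l ->
  ensures H l first sigma a -> play H l first sigma h -> value h <= a.
Proof.
move=> l01 ens; have [n] := ubnP (#|V|.+1 - size h).
elim: n h => // n IHn h lt_n play_h.
have [fin_h|nfin] := pselect (finished H l h); first exact: (ens h play_h).1.
have [m leg turn] : exists2 m, legal_move H l h m &
    on_turn first (size h) = EdgeHitter -> m = sigma h.
  case Dt: (on_turn first (size h)).
    by exists (sigma h) => //; exact: (ens h play_h).2.
  by have [m leg] := legal_move_exists l h; exists m.
have play_hm := play_rcons play_h nfin leg turn.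
have adm := legal_admissible leg.
apply: (@le_trans _ _ (value (rcons h m))).
  by rewrite value_rcons // lerDl spent_ge0.
apply: IHn play_hm; rewrite size_rcons.
have := play_unfinished_size l01 play_h nfin.
by move: lt_n; rewrite ltnS subSS => + le_sz; rewrite subSn.
Qed.

End Plays.

(** * Answering a move under larger loads *)

Section Response.
Context {R : realType} {V : finType}.
Variable H : hypergraph V.
Implicit Types (m : move R V) (h : seq (move R V)) (l : {set V} -> R).

(** The weight bound needs an argument only when m weighs less than 1: then m
    finishes the game from the smaller loads, so its trimmed version already
    fills every edge and no weight is added to it. *)
Lemma trimmed_response l l' h h' m :
  (forall E, E \in H -> load l h E <= load l' h' E) ->
  legal_move H l h m ->
  exists m', [/\ legal_move H l' h' m', spent m' predT <= spent m predT &
    forall E, E \in H -> load l (rcons h m) E <= load l' (rcons h' m') E].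
Proof.
move=> dom leg; have adm := legal_admissible leg.
pose r := [seq (v, spent m (pred1 v)) | v <- enum V].
have tot_r A : total r A = spent m A.
  by rewrite [RHS]spent_sum // /total big_map big_enum_cond.
have r01 : all (fun p => 0 <= p.2 <= 1) r.
  apply/allP => _ /mapP[v _ ->] /=; rewrite spent_ge0 //=.
  apply: le_trans (spent_le1 adm); rewrite [leRHS]spent_sum //.
  by rewrite (bigD1 v) //= lerDl sumr_ge0 // => u _; exact: spent_ge0.
have [s1 /= [leg_s1 tot_s1 s1_or]] :=
  trim_requests (legal_submoves_nil H l' h') r01.
have s1_le : total s1 predT <= spent m predT.
  by rewrite -tot_r; case/andP: (tot_s1 predT).
have s1_le1 : total s1 predT <= 1 by exact: le_trans (spent_le1 adm).
have adm_s1 := list_admissible leg_s1 s1_le1.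
have dom' s2 : admissible (FinMove (s1 ++ s2)) -> (forall A, 0 <= total s2 A) ->
    forall E, E \in H ->
    load l (rcons h m) E <= load l' (rcons h' (FinMove (s1 ++ s2))) E.
  move=> adm_s s2_ge0 E HE; rewrite !load_rcons // spent_list total_cat.
  have s2E_ge0 := s2_ge0 E; have domE := dom E HE.
  rewrite le_min ge_min lexx ge_min /=; apply/orP.
  have [|fill_E] := s1_or E HE; first by rewrite tot_r; right; lra.
  by left; rewrite /fills in fill_E; lra.
have [full|nfull] := pselect (forall E, E \in H -> fills l' h' s1 E).
  exists (FinMove s1); rewrite spent_list; split=> //.
    split=> //; right; split; first by case: adm_s1.
    exact: finished_fills.
  have := dom' [::]; rewrite cats0; apply=> // A; by rewrite total_nil.
have [s2 [leg_s2 s2_ge0 _]] := extend_legal leg_s1 s1_le1.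
have adm_s2 := legal_admissible leg_s2.
exists (FinMove (s1 ++ s2)); split=> //; last exact: dom'.
case: (leg) => _ [|[_ fin]].
  by rewrite weightE // => -[->]; exact: spent_le1.
case: nfull => E HE; have := fin E HE; rewrite load_rcons //.
have := dom E HE; have := s1_or E HE; rewrite tot_r /fills.
by case: (leP 1 (load l h E + spent m E)) => ? [] //; lra.
Qed.

End Response.

(** * The imagined game *)

Section Imagination.
Context {R : realType} {V : finType}.
Variables (H : hypergraph V) (l l' : {set V} -> R) (first : player).
Variable sigma : @strategy R V.

Definition imagined (h' : seq (move R V)) : seq (move R V) :=
  foldl (fun h m =>
           rcons h (if on_turn first (size h) is EdgeHitter then sigma h else m))
        [::] h'.

Lemma imagined_rcons h' m : imagined (rcons h' m) = rcons (imagined h')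
  (if on_turn first (size (imagined h')) is EdgeHitter
   then sigma (imagined h') else m).
Proof. by rewrite /imagined -cats1 foldl_cat. Qed.

Lemma size_imagined h' : size (imagined h') = size h'.
Proof.
by elim/last_ind: h' => // h' m IH; rewrite imagined_rcons !size_rcons IH.
Qed.

Definition dominated h' : Prop :=
  forall E, E \in H -> load l (imagined h') E <= load l' h' E.

(** The answer of Edge-hitter in the real game to the move that sigma makes in the
    imagined one. *)
Definition faithful_response h' m' : Prop :=
  let h := imagined h' in let m := sigma h in
  [/\ legal_move H l' h' m', spent m' predT <= spent m predT &
    forall E, E \in H -> load l (rcons h m) E <= load l' (rcons h' m') E].

Lemma faithful_strategy : exists sigma' : @strategy R V, forall h',
  dominated h' -> legal_move H l (imagined h') (sigma (imagined h')) ->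
  faithful_response h' (sigma' h').
Proof.
have /choice[sigma' sigma'P] : forall h', exists m', dominated h' ->
    legal_move H l (imagined h') (sigma (imagined h')) ->
    faithful_response h' m'.
  move=> h'; have [[dom leg]|no] := pselect (dominated h' /\
      legal_move H l (imagined h') (sigma (imagined h'))).
    by have [m' ?] := trimmed_response dom leg; exists m'.
  by exists (FinMove [::]) => dom leg; case: no.
by exists sigma'.
Qed.

Hypothesis l01 : load_function H l.
Hypothesis le_l : forall E, E \in H -> l E <= l' E.
Variable a : R.
Hypothesis ens : ensures H l first sigma a.
Variable sigma' : @strategy R V.
Hypothesis sigma'P : forall h', dominated h' ->
  legal_move H l (imagined h') (sigma (imagined h')) ->
  faithful_response h' (sigma' h').

(** Restricted to unfinished real games: the copy of a Staller move that ends
    the real game can be illegal in the imagined game. *)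
Lemma imagined_play h' : play H l' first sigma' h' -> ~ finished H l' h' ->
  play H l first sigma (imagined h') /\ dominated h'.
Proof.
elim=> [_|{}h' m' _ IH nfin' leg' turn' nfin].
  split=> [|E HE]; first exact: play_nil.
  rewrite /load big1; last by move=> v _; rewrite /cover_fun big_nil.
  by rewrite !addr0 le_min ge_min lexx ge_min le_l // orbT.
have [play_h dom] := IH nfin'.
have nfin_h : ~ finished H l (imagined h') by move/(finished_dom dom).
rewrite /dominated imagined_rcons; case Dt: (on_turn first (size _)).
  have leg := (ens play_h).2 nfin_h Dt.
  have [_ _ dom'] := sigma'P dom leg.
  split; first exact: play_rcons.
  by rewrite turn' // -size_imagined.
have leg : legal_move H l (imagined h') m'.
  split; first exact: legal_submoves_dom dom leg'.1.
  by case: leg'.2 => [->|[_ /nfin]//]; left.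
have adm := legal_admissible leg.
split=> [|E HE]; first by apply: play_rcons; rewrite ?Dt.
rewrite !load_rcons // le_min ge_min lexx ge_min /=.
by apply/orP; right; rewrite lerD2r dom.
Qed.

Lemma value_faithful h' : play H l' first sigma' h' -> value h' <= a.
Proof.
case=> [|{}h' m' play_h' nfin' leg' turn'].
  exact: ensures_play_value l01 ens (play_nil _ _ _ _).
have [play_h dom] := imagined_play play_h' nfin'.
have nfin : ~ finished H l (imagined h') by move/(finished_dom dom).
have val_eq : value h' = value (imagined h').
  rewrite (play_unfinished_value play_h' nfin').
  by rewrite (play_unfinished_value play_h nfin) size_imagined.
(* Any legal imagined continuation bounds the real value. *)
have via m : legal_move H l (imagined h') m ->
    (on_turn first (size (imagined h')) = EdgeHitter ->
     m = sigma (imagined h')) ->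
    value h' + spent m predT <= a.
  move=> leg turn; rewrite val_eq -value_rcons; last exact: legal_admissible leg.
  by apply: (ensures_play_value l01 ens); exact: play_rcons.
rewrite value_rcons; last exact: legal_admissible leg'.
case Dt: (on_turn first (size (imagined h'))).
  have leg := (ens play_h).2 nfin Dt.
  have [_ le_m _] := sigma'P dom leg.
  rewrite turn'; last by rewrite -size_imagined.
  by have := via _ leg (fun=> erefl); lra.
(* Staller's last move may be too light for the imagined game, so it is
   replaced there by a legal move that loses at most eps. *)
apply/ler_addgt0Pr => eps eps_gt0.
have [m leg le_m] := legal_move_near (legal_submoves_dom dom leg'.1)
  (legal_admissible leg').2 eps_gt0.
have := via m leg; rewrite Dt => /(_ (fun e => match e with end)).
by lra.
Qed.

Lemma ensures_faithful : ensures H l' first sigma' a.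
Proof.
move=> h' play_h'; split=> [_|nfin' turn]; first exact: value_faithful.
have [play_h dom] := imagined_play play_h' nfin'.
have nfin : ~ finished H l (imagined h') by move/(finished_dom dom).
have leg : legal_move H l (imagined h') (sigma (imagined h')).
  by apply: (ens play_h).2; rewrite ?size_imagined.
by have [] := sigma'P dom leg.
Qed.

End Imagination.

Lemma game_value_anti (R : realType) (V : finType) (H : hypergraph V)
    (l l' : {set V} -> R) (first : player) :
  load_function H l ->
  (forall E : {set V}, E \in H -> l E <= l' E) ->
  (game_value H l' first <= game_value H l first)%E.
Proof.
move=> l01 le_l; apply: ereal_inf_le_tmp.
apply: image_subset => a [sigma ens].
have [sigma' sigma'P] := faithful_strategy H l l' first sigma.
exists sigma'; exact: (ensures_faithful l01 le_l ens sigma'P).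
Qed.

Theorem theorem4 (R : realType) (V : finType) (H : hypergraph V)
    (l l' : {set V} -> R)
    (hl : load_function H l) (hl' : load_function H l')
    (hle : forall E : {set V}, E \in H -> l E <= l' E) :
  (tau_g H l >= tau_g H l')%E /\ (tau_g' H l >= tau_g' H l')%E.
Proof. by split; exact: game_value_anti. Qed.
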